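(* For any integer $n \geq 1$, $|\mathcal{F}(n; 312, 231)| = F_{n}$, where $F_{n}$ is the $n$-th Fibonacci number with initial conditions $F_{1} = F_{2} = 1$.
   Context: For a positive integer $n$, $[n]=\{1,\dots,n\}$, and a permutation $\sigma$ of $[n]$ is written as the word $\sigma(1)\sigma(2)\cdots\sigma(n)$. A run of $\sigma$ is a maximal block of consecutive positions on which $\sigma$ is increasing, so $\sigma$ is uniquely the concatenation of its runs; the starting point of a run is its first entry. A flattened partition over $[n]$ is a permutation of $[n]$ whose runs, read from left to right, have increasing starting points. A permutation contains a pattern $\tau$ if it has a (not necessarily contiguous) subsequence order-isomorphic to $\tau$; otherwise it is $\tau$-avoiding. $\mathcal{F}(n;\tau_1,\tau_2)$ is the set of flattened partitions over $[n]$ avoiding both $\tau_1$ and $\tau_2$. The Fibonacci numbers satisfy $F_n=F_{n-1}+F_{n-2}$ for $n\ge 3$. *)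

(* Defs.v *)
From mathcomp Require Import all_boot all_fingroup.
Set Implicit Arguments.
Unset Strict Implicit.
Unset Printing Implicit Defensive.

(* 'S_n permutes {0, .., n-1}; the successor gives the one-line word over
   {1, .., n}. *)
Definition word n (s : 'S_n) : seq nat := [seq (s i).+1 | i <- enum 'I_n].

Fixpoint runs (w : seq nat) : seq (seq nat) :=
  if w is x :: w' then
    match runs w' with
    | (y :: r) :: rs =>
        if x < y then (x :: y :: r) :: rs else [:: x] :: (y :: r) :: rs
    | rs => [:: x] :: rs
    end
  else [::].

(* The next three lemmas characterize runs: the blocks concatenate to the word,
   are nonempty and increasing, and cannot be merged with the next block. *)
Lemma flatten_runs w : flatten (runs w) = w.
Proof.
elim: w => //= x w; case: (runs w) => [|[|y r] rs] //= <- //.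
by case: ifP.
Qed.

Lemma runs_increasing w :
  all (fun r => (r != [::]) && sorted ltn r) (runs w).
Proof.
elim: w => //= x w; case: (runs w) => [|[|y r] rs] //=.
by case: ifP => //= ->.
Qed.

Lemma runs_maximal w :
  sorted (fun r1 r2 => head 0 r2 <= last 0 r1) (runs w).
Proof.
elim: w => //= x w; case: (runs w) => [|[|y r] rs] //=.
by case: ltnP => [_|/= -> //]; case: rs.
Qed.

Definition flattened (w : seq nat) : bool :=
  sorted ltn [seq head 0 r | r <- runs w].

Definition order_isomorphic (u v : seq nat) : bool :=
  (size u == size v) &&
  [forall i : 'I_(size v), forall j : 'I_(size v),
     (nth 0 u i < nth 0 u j) == (nth 0 v i < nth 0 v j)].

Definition contains (tau w : seq nat) : bool :=
  [exists m : (size w).-tuple bool, order_isomorphic (mask m w) tau].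

Definition avoids (tau w : seq nat) : bool := ~~ contains tau w.

Definition flattened_avoiding n (tau1 tau2 : seq nat) : {set 'S_n} :=
  [set s : 'S_n | [&& flattened (word s), avoids tau1 (word s)
                    & avoids tau2 (word s)]].

(* fib 0 = 0 is what makes the recurrence give fib 1 = fib 2 = 1. *)
Fixpoint fib (n : nat) : nat :=
  match n with
  | 0 => 0
  | 1 => 1
  | (m.+1 as p).+1 => fib p + fib m
  end.

(* Main.v *)
Require Import Defs.
From mathcomp Require Import all_boot all_fingroup.
From mathcomp Require Import zify.

(** A word in a flattened partition starts with its least letter, because that
letter starts a run and the run starts increase. What follows this first
letter is a concatenation of blocks [a] and [a.+1; a], the blocks going up by
consecutive values: if the least remaining letter [a] is not the next one, the
next letter [x] cannot be followed by a larger one [y] (with [a] later, [x y a]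
would be a 231), so it is followed by a run start, which is smaller than
everything after it and so equals [a]; and [x] is [a.+1], since otherwise
[x a a.+1] is a 312. This is [flat_avoiding_blocks].

Conversely, in such a concatenation of blocks any two letters that are not
adjacent are in increasing order ([blocks_far_lt]), whereas in both 312 and 231
the first letter exceeds the last; and each run start is the least letter of its
block ([blocks_flat]).

Hence the words are counted by the compositions of [n.-1] into parts 1 and 2,
and splitting off the first part gives the Fibonacci recurrence. *)

(** * Words made of ascending blocks *)

(** These are the direct sums of decreasing words of length one or two, over
the letters [a, .., a + n - 1]; the recursion splits off the first summand. *)
Fixpoint blocks (a n : nat) : seq (seq nat) :=
  match n with
  | 0 => [:: [::]]
  | 1 => [:: [:: a]]
  | (m.+1 as p).+1 =>
      map (cons a) (blocks a.+1 p)
      ++ map (fun w => a.+1 :: a :: w) (blocks a.+2 m)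
  end.

Lemma blocksSS a n : blocks a n.+2 =
  map (cons a) (blocks a.+1 n.+1)
  ++ map (fun w => a.+1 :: a :: w) (blocks a.+2 n).
Proof. by []. Qed.

Lemma size_blocks a n : size (blocks a n) = fib n.+1.
Proof.
elim/ltn_ind: n a => -[|[|n]] // IH a.
rewrite -[fib n.+3]/(fib n.+2 + fib n.+1).
by rewrite blocksSS size_cat !size_map !IH.
Qed.

Lemma uniq_blocks a n : uniq (blocks a n).
Proof.
elim/ltn_ind: n a => -[|[|n]] // IH a.
have inj1 : injective (cons a) by move=> u v [].
have inj2 : injective (fun w => a.+1 :: a :: w) by move=> u v [].
rewrite blocksSS cat_uniq (map_inj_uniq inj1) (map_inj_uniq inj2) !IH //.
rewrite andbT /=; apply/hasPn => _ /mapP[u _ ->].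
by apply/mapP => -[v _ []]; lia.
Qed.

Lemma blocks_perm a n w : w \in blocks a n -> perm_eq w (iota a n).
Proof.
elim/ltn_ind: n a w => -[|[|n]] IH a w; rewrite ?inE.
- by move=> /eqP->.
- by move=> /eqP->.
rewrite blocksSS mem_cat => /orP[] /mapP[u uB ->].
  by rewrite perm_cons; exact: (IH n.+1 _ a.+1).
rewrite -[_ :: _ :: u]/([:: a.+1] ++ [:: a] ++ u) perm_catCA /= !perm_cons.
by apply: (IH n _ a.+2) => //; exact: leqW.
Qed.

Lemma blocks_ge a n w x : w \in blocks a n -> x \in w -> a <= x.
Proof. by move=> /blocks_perm/perm_mem->; rewrite mem_iota => /andP[]. Qed.

(** Between [p] and [r] there is another letter, so they lie in different
blocks, and the letters of a later block are larger. *)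
Lemma blocks_far_lt a n w p q r :
  w \in blocks a n -> subseq [:: p; q; r] w -> p < r.
Proof.
have tl (x y z : nat) (u : seq nat) : subseq [:: x; y] (z :: u) -> y \in u.
  rewrite /=; case: eqP => _; first by rewrite sub1seq.
  by move=> /mem_subseq; apply; rewrite !inE eqxx orbT.
elim/ltn_ind: n a w => -[|[|n]] IH a w; rewrite ?inE.
- by move=> /eqP->.
- by move=> /eqP-> /size_subseq.
rewrite blocksSS mem_cat => /orP[] /mapP[u uB ->].
  have [->|pa] := eqVneq p a; last first.
    by rewrite [subseq _ _]/= (negPf pa); exact: (IH n.+1 _ a.+1).
  rewrite [subseq _ _]/= eqxx => /mem_subseq/(_ r).
  by rewrite !inE eqxx orbT => /(_ isT); exact: blocks_ge uB.
have [->|pa1] := eqVneq p a.+1.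
  by rewrite [subseq _ _]/= eqxx => /tl; exact: blocks_ge uB.
rewrite [subseq _ _]/= (negPf pa1); have [->|pa] := eqVneq p a.
  move=> /mem_subseq/(_ r); rewrite !inE eqxx orbT => /(_ isT) ru.
  exact/ltnW/(blocks_ge _ _ _ _ uB ru).
by apply: (IH n _ a.+2) => //; exact: leqW.
Qed.

(** * Run starts *)

(** The run starts of [x :: w] other than [x]: whether a letter starts a run
depends only on the letter before it, so a suffix can be treated alone once the
letter [x] before it is known. *)
Fixpoint next_starts (x : nat) (w : seq nat) : seq nat :=
  if w is y :: w' then
    if x < y then next_starts y w' else y :: next_starts y w'
  else [::].

Lemma flattened_cons x w : flattened (x :: w) = path ltn x (next_starts x w).
Proof.
suff: [seq head 0 r | r <- runs (x :: w)] = x :: next_starts x w.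
  by rewrite /flattened => ->.
elim: w x => // y w IH x; move: (IH y).
rewrite -[runs (x :: _)]/(match runs (y :: w) with
    | (y :: r) :: rs =>
        if x < y then (x :: y :: r) :: rs else [:: x] :: (y :: r) :: rs
    | rs => [:: x] :: rs
    end).
have := runs_increasing (y :: w).
case: (runs (y :: w)) => [|[|z r] rs] // _ [-> startsE] /=.
by rewrite -startsE; case: ifP.
Qed.

(** Here [c] is the start of the run that contains [x]. The run starts to come
exceed [c], and every other letter exceeds the start of its run. *)
Lemma starts_lt c x w :
  c <= x -> path ltn c (next_starts x w) -> all (ltn c) w.
Proof.
elim: w c x => //= y w IH c x cx; case: ifP => [xy|_ /= /andP[cy yw]].
  have cy := leq_ltn_trans cx xy.
  by move=> cw; rewrite cy (IH c y (ltnW cy)).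
rewrite cy; apply: sub_all (IH y y (leqnn y) yw) => z; exact: ltn_trans.
Qed.

(** As above, [c] is the start of the run that contains [x]. A block [b] extends
the current run; in a block [b.+1; b] only [b] starts a run, and it is larger
than all the letters before the block. *)
Lemma blocks_flat a n w c x :
  w \in blocks a n -> c <= x < a -> path ltn c (next_starts x w).
Proof.
elim/ltn_ind: n a w c x => -[|[|n]] IH a w c x; rewrite ?inE.
- by move=> /eqP->.
- by move=> /eqP-> /andP[_ xa] /=; rewrite xa.
rewrite blocksSS mem_cat => /orP[] /mapP[u uB ->] /andP[cx xa] /=.
  by rewrite xa; apply: (IH n.+1 _ a.+1) => //; lia.
have -> : x < a.+1 by lia.
have -> : a.+1 < a = false by lia.
rewrite /= (leq_ltn_trans cx xa) /=.
by apply: (IH n _ a.+2) => //; lia.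
Qed.

(** * Pattern containment *)

Lemma containsP tau w :
  reflect (exists2 u, subseq u w & order_isomorphic u tau) (contains tau w).
Proof.
apply: (iffP existsP) => [[m om]|[u /subseqP[m sm ->] om]].
  by exists (mask m w); rewrite ?mask_subseq.
by exists (tcast sm (in_tuple m)); rewrite val_tcast.
Qed.

(** With lists of indices in place of ordinals, the condition computes when [v]
is an explicit pattern, to a boolean combination of linear inequalities. *)
Lemma order_isomorphicE (u v : seq nat) : order_isomorphic u v =
  (size u == size v) &&
  all (fun i => all (fun j => (nth 0 u i < nth 0 u j) ==
                              (nth 0 v i < nth 0 v j)) (iota 0 (size v)))
      (iota 0 (size v)).
Proof.
rewrite /order_isomorphic; congr (_ && _).
apply/forallP/allP => [H i|H i].
  rewrite mem_iota => iv; apply/allP => j; rewrite mem_iota => jv.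
  exact: (forallP (H (Ordinal iv)) (Ordinal jv)).
apply/forallP => j.
by apply: (allP (H i _)); rewrite mem_iota /= ltn_ord.
Qed.

Lemma contains_312P w :
  reflect (exists p q r, subseq [:: p; q; r] w /\ q < r < p)
          (contains [:: 3; 1; 2] w).
Proof.
apply: (iffP (containsP _ _)) => [[u uw]|[p [q [r [sw lt]]]]].
  rewrite order_isomorphicE; case: u uw => [|p [|q [|r []]]] //= uw H.
  by exists p, q, r; split=> //; lia.
by exists [:: p; q; r] => //; rewrite order_isomorphicE /=; lia.
Qed.

Lemma contains_231P w :
  reflect (exists p q r, subseq [:: p; q; r] w /\ r < p < q)
          (contains [:: 2; 3; 1] w).
Proof.
apply: (iffP (containsP _ _)) => [[u uw]|[p [q [r [sw lt]]]]].
  rewrite order_isomorphicE; case: u uw => [|p [|q [|r []]]] //= uw H.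
  by exists p, q, r; split=> //; lia.
by exists [:: p; q; r] => //; rewrite order_isomorphicE /=; lia.
Qed.

Lemma avoids_subseq tau u w : subseq u w -> avoids tau w -> avoids tau u.
Proof.
move=> uw; apply: contraNN => /containsP[v vu tv].
by apply/containsP; exists v => //; exact: subseq_trans uw.
Qed.

Lemma blocks_avoid a n w : w \in blocks a n ->
  avoids [:: 3; 1; 2] w && avoids [:: 2; 3; 1] w.
Proof.
move=> wB; apply/andP; split.
  apply/contains_312P => -[p [q [r [/(blocks_far_lt _ _ _ _ _ _ wB)]]]]; lia.
apply/contains_231P => -[p [q [r [/(blocks_far_lt _ _ _ _ _ _ wB)]]]]; lia.
Qed.

(** * Block decomposition of the words *)

(** The letters [c <= x] stand for the last run start and the last letter of
what precedes [w], so that the induction goes through suffixes. *)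
Lemma flat_avoiding_blocks a n w c x :
  perm_eq w (iota a n) -> c <= x < a -> path ltn c (next_starts x w) ->
  avoids [:: 3; 1; 2] w -> avoids [:: 2; 3; 1] w -> w \in blocks a n.
Proof.
elim/ltn_ind: n a w c x => -[|[|n]] IH a w c x.
- by move=> /perm_nilP->; rewrite inE.
- by rewrite [iota _ _]/= => /perm_small_eq-> //; rewrite inE.
case: w => [|y w] pw; first by move/perm_size: pw.
have memw z : (z \in y :: w) = (a <= z < a + n.+2).
  by rewrite (perm_mem pw) mem_iota.
move=> /andP[cx xa] fw av1 av2; rewrite blocksSS mem_cat.
have [ya|ya] := eqVneq y a.
  apply/orP; left; subst y; apply: map_f; move: pw fw; rewrite /= xa perm_cons.
  move=> pw fw; apply: (IH n.+1 _ a.+1 w c a) => //; first lia.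
  - exact: avoids_subseq (subseq_cons w a) av1.
  - exact: avoids_subseq (subseq_cons w a) av2.
(* Now [y] is not the least letter [a], and the block is [y; a] with
   [y = a.+1]. *)
have ay : a < y by have := memw y; rewrite inE eqxx; lia.
have aw : a \in w.
  by have := memw a; rewrite inE eq_sym (negPf ya) /= => ->; lia.
case: w => // z w in pw memw fw av1 av2 aw *.
(* Otherwise [y; z; a] is a 231. *)
have zy : (y < z) = false.
  apply/negP => yz; case/contains_231P: av2; exists y, z, a.
  rewrite /= !eqxx sub1seq; split; last by lia.
  by move: aw; rewrite inE => /predU1P[] // az; lia.
have xy : x < y by lia.
move: fw; rewrite /= xy zy /= => /andP[_ fz].
(* [z] starts a run, so it is below all later letters; [a] is not before it. *)
have za : z = a.
  have az : a <= z by have := memw z; rewrite !inE eqxx orbT; lia.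
  move: aw; rewrite inE => /predU1P[//|aw].
  by have /= := allP (starts_lt _ _ _ (leqnn z) fz) a aw; lia.
(* Otherwise [y; a; a.+1] is a 312. *)
subst z; have ya1 : y = a.+1.
  apply/eqP/negPn/negP => ya1; case/contains_312P: av1; exists y, a, a.+1.
  rewrite /= !eqxx sub1seq; split; last by lia.
  have := memw a.+1; rewrite !inE eq_sym (negPf ya1).
  by rewrite (gtn_eqF (ltnSn a)) /= => ->; lia.
subst y; apply/orP; right; apply: (map_f (fun u => a.+1 :: a :: u)).
have tlw : subseq w [:: a.+1, a & w] by exact: (suffix_subseq [:: a.+1; a]).
apply: (IH n _ a.+2 w a a) => //; try lia.
- move: pw; rewrite -[_ :: _ :: w]/([:: a.+1] ++ [:: a] ++ w) perm_catCA /=.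
  by rewrite !perm_cons.
- exact: avoids_subseq tlw av1.
- exact: avoids_subseq tlw av2.
Qed.

(** The first letter [x] starts the first run, so it is less than every other
letter and is 1; it then serves as both [c] and [x] in the two block lemmas. *)
Lemma flattened_avoiding_blocks n w : perm_eq w (iota 1 n.+1) ->
  [&& flattened w, avoids [:: 3; 1; 2] w & avoids [:: 2; 3; 1] w]
  = (w \in map (cons 1) (blocks 2 n)).
Proof.
move=> pw; apply/idP/mapP => [/and3P[fw av1 av2]|[u uB ->]].
  case: w => [|x w] in pw fw av1 av2 *; first by move/perm_size: pw.
  rewrite flattened_cons in fw.
  have x1 : x = 1.
    have := perm_mem pw x; rewrite mem_iota inE eqxx /= => /esym/andP[x1 _].
    have := perm_mem pw 1; rewrite mem_iota inE /= => /predU1P[//|w1].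
    by have /= := allP (starts_lt _ _ _ (leqnn x) fw) 1 w1; lia.
  subst x; exists w => //; rewrite perm_cons in pw.
  apply: (flat_avoiding_blocks _ _ _ _ _ pw _ fw) => //.
  - exact: avoids_subseq (subseq_cons w 1) av1.
  - exact: avoids_subseq (subseq_cons w 1) av2.
rewrite flattened_cons (blocks_flat _ _ _ _ _ uB) //=.
(* [1 :: u] is itself made of blocks, the first being [1]. *)
apply: (blocks_avoid 1 n.+1); case: n uB {pw} => [|n] uB.
  by move: uB; rewrite !inE => /eqP->.
by rewrite blocksSS mem_cat map_f.
Qed.

(** * Counting permutations by their words *)

Lemma word_inj n : injective (@word n).
Proof.
move=> s t st; apply/permP => i; apply/val_inj/succn_inj.
have /eq_in_map : word s = word t by [].
by apply; rewrite mem_enum.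
Qed.

Lemma word_perm n (s : 'S_n) : perm_eq (word s) (iota 1 n).
Proof.
have inj : injective (fun i => (s i).+1) by move=> i j [/val_inj/perm_inj].
apply: uniq_perm; rewrite ?iota_uniq ?(map_inj_uniq inj) ?enum_uniq //.
move=> k; rewrite mem_iota; apply/mapP/idP => [[i _ ->]|/andP[k0 kn]].
  by rewrite add1n !ltnS ltn_ord.
have kn' : k.-1 < n by lia.
exists (s^-1%g (Ordinal kn')); first by rewrite mem_enum.
by rewrite permKV /= prednK.
Qed.

Lemma word_surj n w : perm_eq w (iota 1 n) -> exists s : 'S_n, word s = w.
Proof.
move=> pw; have sw : size w = n by rewrite (perm_size pw) size_iota.
have uw : uniq w by rewrite (perm_uniq pw) iota_uniq.
have wi (i : 'I_n) : 0 < nth 0 w i <= n.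
  have: nth 0 w i \in w by rewrite mem_nth ?sw.
  by rewrite (perm_mem pw) mem_iota; lia.
have wn (i : 'I_n) : (nth 0 w i).-1 < n by have := wi i; lia.
have inj : injective (fun i => Ordinal (wn i)).
  move=> i j [eij]; apply/val_inj/eqP.
  rewrite -(nth_uniq 0 _ _ uw) ?sw //=.
  by have := wi i; have := wi j; lia.
exists (perm inj); rewrite -[RHS](mkseq_nth 0) sw /mkseq -val_enum_ord -map_comp.
by apply: eq_map => i; rewrite /= permE /= prednK //; case/andP: (wi i).
Qed.

Theorem proposition3p7 (n : nat) (hn : 0 < n) :
  #|flattened_avoiding n [:: 3; 1; 2] [:: 2; 3; 1]| = fib n.
Proof.
case: n hn => // n _.
rewrite -(size_blocks 2) -(size_map (cons 1)) cardE -(size_map (@word n.+1)).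
apply/perm_size/uniq_perm.
- by rewrite (map_inj_uniq (word_inj _)) enum_uniq.
- by rewrite map_inj_uniq ?uniq_blocks // => u v [].
move=> w; apply/mapP/idP => [[s]|wB].
  have := flattened_avoiding_blocks _ _ (word_perm _ s).
  by rewrite mem_enum inE => -> ? ->.
have pw : perm_eq w (iota 1 n.+1).
  by case/mapP: wB => u uB ->; rewrite perm_cons; exact: blocks_perm uB.
have [s sw] := word_surj _ _ pw; exists s => //.
by rewrite mem_enum inE sw (flattened_avoiding_blocks _ _ pw).
Qed.
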